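(* Let $p$ be an even positive integer and $\tau,i,j$ non-negative integers. Let $\mu=\frac{p^2}{4}+2p+2$, $\gamma=2\mu-\left(\frac p2+4\right)$, $m=\mu+\tau\frac p2$, $g=\gamma+\tau(p-1)$, $c=p\mu+\tau\left(\frac{p^2}{2}-1\right)$, $S(p,\tau)=\langle m,g,g+1\rangle_c$; and let $m^{(i,j)}=m+j\frac p2$, $g^{(i,j)}=g+j(p-1)+i\,m^{(i,j)}$, $c^{(i,j)}=c+j\frac{p^2}{2}+i\left(\frac p2+1\right)m^{(i,j)}$, $S^{(i,j)}(p,\tau)=\langle m^{(i,j)},g^{(i,j)},g^{(i,j)}+1\rangle_{c^{(i,j)}}$. Then $$\mathrm{E}(S^{(i,j)}(p,\tau))=\mathrm{E}(S(p,\tau)).$$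
   Context: A numerical semigroup is a submonoid of $(\mathbb N,+)$ with finite complement. For integers $a_1,\dots,a_r$ and $t$, $\langle a_1,\dots,a_r\rangle_t$ denotes the smallest numerical semigroup containing $a_1,\dots,a_r$ and all integers $\ge t$. For a numerical semigroup $S$: conductor $c(S)$ is the smallest integer such that all integers $\ge c(S)$ are in $S$; multiplicity $m(S)$ is its least positive element; $L=\{s\in S: s<c(S)\}$; $P$ is the set of minimal generators; $q=\lceil c(S)/m(S)\rceil$; $\rho=q\,m(S)-c(S)$; $I_q=\{z\in\mathbb Z: c(S)\le z<c(S)+m(S)\}$; $D_q=I_q\setminus P$. The Eliahou number is $\mathrm{E}(S)=|P\cap L|\,|L|-q\,|D_q|+\rho$. *)

(* Defs.v *)
From mathcomp Require Import all_boot all_order all_algebra finmap.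
From mathcomp Require Import boolp classical_sets functions cardinality.

Set Implicit Arguments.
Unset Strict Implicit.
Unset Printing Implicit Defensive.

Import Order.TTheory GRing.Theory Num.Theory.

Local Open Scope classical_set_scope.
Local Open Scope nat_scope.

Definition submonoid (S : set nat) : Prop :=
  S 0 /\ forall x y, S x -> S y -> S (x + y).

Definition numerical_semigroup (S : set nat) : Prop :=
  submonoid S /\ finite_set (~` S).

(* <A>_t; the intersection defining [smallest] is itself a numerical semigroup,
   since every member of the family contains all integers >= t. *)
Definition gen_trunc (A : set nat) (t : nat) : set nat :=
  smallest numerical_semigroup (A `|` [set n | t <= n]).

(* Minimum of a nonempty set of natural numbers (junk value 0 on set0). *)
Definition least (A : set nat) : nat := xget 0 (A `&` lbound A).

Definition card_set (A : set nat) : nat := #|` fset_set A|.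

Section Invariants.
Variable S : set nat.

Definition conductor : nat := least [set c | forall n, c <= n -> S n].

Definition multiplicity : nat := least [set n | S n /\ 0 < n].

Definition left_part : set nat := [set s | S s /\ s < conductor].

Definition generates (A : set nat) : Prop := smallest submonoid A = S.

Definition minimal_generating_set (A : set nat) : Prop :=
  generates A /\ forall B, B `<=` A -> generates B -> B = A.

(* A submonoid of nat has exactly one minimal generating set, so the union of
   all of them is that set. *)
Definition min_gens : set nat :=
  [set x | exists2 A, minimal_generating_set A & A x].

Definition last_interval : set nat :=
  [set z | conductor <= z < conductor + multiplicity].

Definition last_decomposable : set nat := last_interval `\` min_gens.

Local Open Scope ring_scope.

Definition depth : int := Num.ceil (conductor%:R / multiplicity%:R : rat).

Definition rho : int := depth * multiplicity%:Z - conductor%:Z.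

Definition eliahou : int :=
  (card_set (min_gens `&` left_part))%:Z * (card_set left_part)%:Z
  - depth * (card_set last_decomposable)%:Z + rho.

End Invariants.

(* For positive even p every division below is exact and no subtraction is
   truncated. *)
Section Family.
Variables p tau : nat.

Definition mu : nat := p ^ 2 %/ 4 + 2 * p + 2.
Definition gamma : nat := 2 * mu - (p %/ 2 + 4).

Definition Sm : nat := mu + tau * (p %/ 2).
Definition Sg : nat := gamma + tau * (p - 1).
Definition Sc : nat := p * mu + tau * (p ^ 2 %/ 2 - 1).

Definition Spt : set nat := gen_trunc [set Sm; Sg; Sg + 1] Sc.

Variables i j : nat.

Definition Sm_ij : nat := Sm + j * (p %/ 2).
Definition Sg_ij : nat := Sg + j * (p - 1) + i * Sm_ij.
Definition Sc_ij : nat := Sc + j * (p ^ 2 %/ 2) + i * (p %/ 2 + 1) * Sm_ij.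

Definition Spt_ij : set nat := gen_trunc [set Sm_ij; Sg_ij; Sg_ij + 1] Sc_ij.

End Family.

(* Main.v *)
(* Write p = 2k, M, G, C for the parameters of S^(i,j), N = k+4+tau+j and
   Q = 2k + i(k+1).  Then M = kN + 2, G = (i+2)M - N and C = QM - tau, so that Q is
   the depth and rho = tau.  The elements aM + bG + e (0 <= e <= b) of <M,G,G+1>
   with b <= k+1 have a unique such representation, since their residues mod M lie in
   disjoint blocks, and for each (b,e) exactly one a, say alpha(b), puts
   aM + bG + e in [C, C+M); levels b >= k+2 lie above C+M.  Hence
   |L| = sum_(b <= k+1) (b+1) alpha(b), |D_q| = sum_(b <= k+1) (b+1) and
   P n L = {M,G,G+1}.  Since alpha(b) = i(k+1-b) + (a term not involving i, j),
   the dependence of E on i cancels by the identity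
   3 sum_(b <= n) (n-b)(b+1) = n sum_(b <= n) (b+1) at n = k+1. *)
Require Import Defs.
From mathcomp Require Import all_boot all_order all_algebra.
From mathcomp Require Import finmap boolp classical_sets cardinality.
From mathcomp Require Import zify lra.

Local Open Scope classical_set_scope.
Local Open Scope nat_scope.

(** * Minima and cardinalities of explicit sets *)

Lemma least_eq (A : set nat) n : A n -> lbound A n -> least A = n.
Proof.
move=> An lbn; apply: xget_unique => // y [Ay lby].
by apply/eqP; rewrite eqn_leq [_ <= n]lby // [n <= _]lbn.
Qed.

Lemma card_set_seq (s : seq nat) : uniq s -> card_set [set` s] = size s.
Proof.
move=> us; rewrite /card_set.
have -> : [set` s] = [set` [fset x in s]%fset].
  by apply/seteqP; split => x /=; rewrite inE.
by rewrite set_fsetK card_fseq undup_id.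
Qed.

(** * Minimal generators as irreducible elements; depth and [rho] *)

Definition atoms (S : set nat) : set nat :=
  [set x | [/\ S x, 0 < x &
    forall y z, S y -> S z -> x = y + z -> y = 0 \/ z = 0]].

(** A positive non-atom is a sum of two smaller positive elements of S, so strong induction
    applies. *)
Lemma generates_atoms {S : set nat} : submonoid S -> generates S (atoms S).
Proof.
move=> [S0 SD]; apply/seteqP; split.
  by apply: smallest_sub => // x [].
move=> x Sx N [[N0 ND] atN]; elim/ltn_ind: x Sx => x IH Sx.
have [->//|x0] := posnP x.
have [/atN//|nat] := pselect (atoms S x).
have [y [z [Sy Sz xyz y0 z0]]] :
    exists y z, [/\ S y, S z, x = y + z, 0 < y & 0 < z].
  apply: contrapT => H; apply: nat; split => // y z Sy Sz xyz.
  have [|y0] := posnP y; first by left.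
  have [|z0] := posnP z; first by right.
  by case: H; exists y, z.
by rewrite xyz; apply: ND; apply: IH => //; lia.
Qed.

(** Removing an atom x from S leaves a submonoid, so generators avoiding x cannot produce x. *)
Lemma atoms_sub_generates (S A : set nat) :
  submonoid S -> generates S A -> atoms S `<=` A.
Proof.
move=> [S0 SD] gA x [Sx x0 irr]; apply: contrapT => nAx.
have AS : A `<=` S by rewrite -gA; exact: sub_gen_smallest.
suff : (S `\ x) x by case=> _; apply.
suff : S `<=` S `\ x by apply.
rewrite -{1}gA; apply: smallest_sub.
  split; first by split => //= ?; lia.
  move=> y z [Sy /= yx] [Sz /= zx]; split; first exact: SD.
  by move=> /= /esym xyz; case: (irr y z Sy Sz xyz) => ?; lia.
by move=> y Ay; split; [exact: AS|move=> /= yx; apply: nAx; rewrite -yx].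
Qed.

Lemma min_gensE {S : set nat} : submonoid S -> min_gens S = atoms S.
Proof.
move=> subS; have gen_at := generates_atoms subS.
apply/seteqP; split=> x.
  move=> [A [gA minA] Ax].
  by rewrite (minA _ (atoms_sub_generates _ _ subS gA) gen_at).
move=> atx; exists (atoms S) => //; split => // B Bat gB.
by apply/seteqP; split => //; exact: atoms_sub_generates.
Qed.

Lemma depth_rho {S : set nat} Q r : r < multiplicity S ->
  conductor S + r = Q * multiplicity S -> depth S = Q /\ rho S = r.
Proof.
set m := multiplicity S; set c := conductor S => rm crQ.
have dQ : depth S = Q.
  apply/eqP; rewrite /depth Num.Theory.ceil_eq -/m -/c.
  have m0 : (0 < m%:R :> rat)%R by rewrite Num.Theory.ltr0n; lia.
  rewrite Num.Theory.ltr_pdivlMr // Num.Theory.ler_pdivrMr //.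
  have : (c%:R + r%:R = Q%:R * m%:R :> rat)%R.
    by rewrite -GRing.natrD crQ GRing.natrM.
  have : (0 <= r%:R :> rat)%R by rewrite Num.Theory.ler0n.
  have : (r%:R < m%:R :> rat)%R by rewrite Num.Theory.ltr_nat.
  rewrite GRing.rmorphB /= -!pmulrn => *; apply/andP; split; lra.
by split=> //; rewrite /rho dQ -/m -/c; lia.
Qed.

(** * Truncated semigroups on M, G, G + 1 *)

(* The submonoid generated by M, G, G + 1: the parameter b counts the summands
   G or G + 1, and e those equal to G + 1. *)
Definition gap_monoid (M G : nat) : set nat :=
  [set x | exists a b e, e <= b /\ x = a * M + b * G + e].

Lemma gap_monoidD M G x y :
  gap_monoid M G x -> gap_monoid M G y -> gap_monoid M G (x + y).
Proof.
move=> [a [b [e [eb ->]]]] [a' [b' [e' [eb' ->]]]].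
by exists (a + a'), (b + b'), (e + e'); split; [lia|rewrite !mulnDl; lia].
Qed.

Lemma submonoid_mul (N : set nat) n x : submonoid N -> N x -> N (n * x).
Proof.
by move=> [N0 ND] Nx; elim: n => // n IH; rewrite mulSn; apply: ND.
Qed.

Lemma gen_truncE M G C :
  gen_trunc [set M; G; G + 1] C = gap_monoid M G `|` [set n | C <= n].
Proof.
apply/seteqP; split.
  apply: smallest_sub.
    split.
      split; first by left; exists 0, 0, 0.
      move=> x y [Tx|/= Cx]; last by right => /=; lia.
      case=> [Ty|/= Cy]; last by right => /=; lia.
      by left; exact: gap_monoidD.
    apply: (sub_finite_set _ (finite_II C)) => x /=; move=> /not_orP [_ /=].
    by lia.
  move=> x [[[]|]|]; first by move=> ->; left; exists 1, 0, 0; split; lia.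
  - by move=> ->; left; exists 0, 1, 0; split; lia.
  - by move=> ->; left; exists 0, 1, 1; split; lia.
  - by right.
move=> x [[a [b [e [eb ->]]]]|/= Cx] N [[subN _] AN]; last first.
  by apply: AN; right.
have [_ ND] := subN.
have -> : a * M + b * G + e = a * M + (b - e) * G + e * (G + 1).
  by rewrite -[in LHS](subnK eb) mulnDl mulnDr; lia.
by apply: (ND); first apply: (ND);
  apply: submonoid_mul => //; apply: AN; left; rewrite /=; tauto.
Qed.

Lemma sumn_map_iota (f : nat -> nat) n :
  sumn [seq f i | i <- iota 0 n] = \sum_(i < n) f i.
Proof. by rewrite sumnE big_map -{1}(subn0 n) big_mkord. Qed.

(** * The Eliahou number from unique representations *)

Section EliahouGenTrunc.
Variables (M G C Q r K : nat) (alpha : nat -> nat).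
Hypotheses (rM : r < M) (MG : M < G) (GC : G + 1 < C) (K0 : 0 < K).
Hypothesis CQ : C + r = Q * M.
Hypothesis window : forall b e, b <= K -> e <= b ->
  C <= alpha b * M + b * G + e < C + M.
Hypothesis beyond : C + M <= K.+1 * G.
Hypothesis repr_inj : forall a b e a' b' e',
  b <= K -> b' <= K -> e <= b -> e' <= b' ->
  a * M + b * G + e = a' * M + b' * G + e' -> [/\ a = a', b = b' & e = e'].
(** This makes C the exact conductor, not only an upper bound for it. *)
Hypothesis gapC : ~ gap_monoid M G C.-1.

Local Notation S := (gen_trunc [set M; G; G + 1] C).

Let inS x : S x <-> gap_monoid M G x \/ C <= x.
Proof. by rewrite gen_truncE. Qed.

Let subS : submonoid S.
Proof.
split; first by apply/inS; left; exists 0, 0, 0.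
move=> x y /inS[Tx|Cx] /inS[Ty|Cy]; apply/inS; try by right; lia.
by left; exact: gap_monoidD.
Qed.

Let level_le a b e : a * M + b * G + e < C + M -> b <= K.
Proof.
move=> lt; rewrite leqNgt; apply/negP => Kb.
by have := leq_mul Kb (leqnn G); lia.
Qed.

(** At a = [alpha b] the value lies in [C, C + M), and each unit of a shifts it by M, the length of
    that interval. *)
Let coef_lt a b e : b <= K -> e <= b -> (a * M + b * G + e < C) = (a < alpha b).
Proof.
move=> bK eb; have /andP[lo hi] := window _ _ bK eb.
apply/idP/idP => [lt|alt].
  rewrite ltnNge; apply/negP => le.
  by have := leq_mul le (leqnn M); lia.
by have := leq_mul alt (leqnn M); rewrite mulSn; lia.
Qed.

Let coef_eq a b e : b <= K -> e <= b ->
  C <= a * M + b * G + e < C + M -> a = alpha b.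
Proof.
move=> bK eb /andP[lo hi]; have := coef_lt a b e bK eb.
have := coef_lt a.-1 b e bK eb.
have /andP[lo' hi'] := window b e bK eb.
have : a = 0 \/ a * M = M + a.-1 * M by case: (a) => [|a']; [left|right].
lia.
Qed.

Let conductorE : conductor S = C.
Proof.
apply: least_eq => [n Cn|c Hc]; first by apply/inS; right.
rewrite Order.NatOrder.leEnat leqNgt; apply/negP => cC.
have /inS[//|] : S C.-1 by apply: Hc; lia.
by lia.
Qed.

Let pos_ge x : S x -> 0 < x -> M <= x.
Proof.
move=> /inS[[a [b [e [eb ->]]]]|]; last by lia.
case: a => [|a]; last by rewrite mulSn; lia.
by case: b eb => [|b]; rewrite ?mulSn; lia.
Qed.

Let multiplicityE : multiplicity S = M.
Proof.
apply: least_eq => [|x [Sx x0]]; last exact: pos_ge.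
by split; [apply/inS; left; exists 1, 0, 0; split; lia|lia].
Qed.

Let left_partE : left_part S =
  [set` [seq ae.1 * M + b * G + ae.2 | b <- iota 0 K.+1,
           ae <- [seq (a, e) | a <- iota 0 (alpha b), e <- iota 0 b.+1]]].
Proof.
set s := flatten _.
rewrite /left_part conductorE; apply/seteqP; split => x /=; rewrite {}/s.
  move=> [/inS[[a [b [e [eb ->]]]]|]]; last by lia.
  move=> lt; have bK : b <= K by apply: (level_le a b e); lia.
  apply/allpairsPdep; exists b, (a, e); split => //; first by rewrite mem_iota.
  by apply: allpairs_f; rewrite mem_iota ?add0n // -(coef_lt a b e).
move=> /allpairsPdep[b [_ [bK /allpairsP[[a e] [aal eb ->]] ->]]] /=.
rewrite !mem_iota /= in bK aal eb.
have -> : a * M + b * G + e < C by rewrite coef_lt; lia.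
by split => //; apply/inS; left; exists a, b, e; split; lia.
Qed.

Let card_left_part : card_set (left_part S) = \sum_(b < K.+1) alpha b * b.+1.
Proof.
rewrite left_partE card_set_seq.
  rewrite size_allpairs_dep -(sumn_map_iota (fun b => alpha b * b.+1)).
  congr sumn.
  by apply: eq_map => b; rewrite size_allpairs !size_iota.
apply: allpairs_uniq_dep; first exact: iota_uniq.
  move=> b _; apply: allpairs_uniq; rewrite ?iota_uniq //.
  by move=> [? ?] [? ?].
move=> u v /allpairsPdep[b [_ [bK /allpairsP[[a e] [aal eb ->]] ->]]].
move=> /allpairsPdep[b' [_ [bK' /allpairsP[[a' e'] [aal' eb' ->]] ->]]] /=.
rewrite !mem_iota /= in bK bK' eb eb'.
by move/repr_inj => /(_ bK bK' eb eb')[-> -> ->].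
Qed.

(** A generator splits off any longer sum. Conversely, a sum of two nonzero elements below C uses at
    least two generators, while the unique representations of M, G, G + 1 use one. *)
Let atom_lt x : x < C -> atoms S x <-> [\/ x = M, x = G | x = G + 1].
Proof.
move=> xC; split.
  move=> [/inS[[a [b [e [eb xE]]]]|] x0 irr]; last by lia.
  have SM : S M by apply/inS; left; exists 1, 0, 0; split; lia.
  have SG e' : e' <= 1 -> S (G + e').
    by move=> ?; apply/inS; left; exists 0, 1, e'; split; lia.
  case: a xE => [|a] xE; last first.
    case: (irr M (a * M + b * G + e)); rewrite ?xE ?mulSn //; try lia.
      by apply/inS; left; exists a, b, e.
    by move=> z; constructor 1; lia.
  case: b eb xE => [|b] eb xE; first by lia.
  (* The summand split off is G + 1 exactly when e = b + 1, that is, when no summand G is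
     present. *)
  case: (irr (G + (e - b)) (b * G + minn e b)); rewrite ?xE ?mulSn; try lia.
  - by apply: SG; lia.
  - by apply/inS; left; exists 0, b, (minn e b); split; lia.
  - move=> z; case: e eb xE z => [|[|e]] eb xE z; try by constructor 2; lia.
    by constructor 3; lia.
have key b e : b <= 1 -> e <= b -> x = (1 - b) * M + b * G + e -> atoms S x.
  move=> b1 eb xE; split.
  - by apply/inS; left; exists (1 - b), b, e.
  - by case: b b1 eb xE => [|[|]]; lia.
  move=> y z Sy Sz xyz.
  have [->|y0] := posnP y; first by left.
  have [->|z0] := posnP z; first by right.
  have /inS[[a1 [b1' [e1 [eb1 yE]]]]|] := Sy; last by lia.
  have /inS[[a2 [b2 [e2 [eb2 zE]]]]|] := Sz; last by lia.
  have xE' : x = (a1 + a2) * M + (b1' + b2) * G + (e1 + e2).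
    by rewrite xyz yE zE !mulnDl; lia.
  have bK : b1' + b2 <= K by apply: (level_le (a1 + a2) _ (e1 + e2)); lia.
  have [|||||A B E] := repr_inj (1 - b) b e (a1 + a2) (b1' + b2) (e1 + e2);
    try lia.
  (* Comparing coefficients gives a1 + a2 + b1' + b2 = 1, so one part has both coefficients 0, and e
     <= b makes it 0. *)
  have [[? ?]|[? ?]] : (a1 = 0 /\ b1' = 0) \/ (a2 = 0 /\ b2 = 0) by lia.
    by left; subst; lia.
  by right; subst; lia.
case=> xE; [apply: (key 0 0)|apply: (key 1 0)|apply: (key 1 1)]; lia.
Qed.

Let card_atoms_left : card_set (min_gens S `&` left_part S) = 3.
Proof.
rewrite (min_gensE subS).
have -> : atoms S `&` left_part S = [set` [:: M; G; G + 1]].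
  rewrite /left_part conductorE; apply/seteqP; split => x /=.
    by move=> [atx [_ xC]]; move: atx => /(atom_lt _ xC)[] ->;
      rewrite !inE eqxx ?orbT.
  move=> xin; have xC : x < C by move: xin; rewrite !inE; lia.
  have atx : atoms S x.
    by apply/(atom_lt _ xC); move: xin; rewrite !inE => /or3P[]/eqP->;
      [constructor 1|constructor 2|constructor 3].
  by split => //; split => //; case: atx.
by rewrite card_set_seq //= !inE; lia.
Qed.

(** Both parts of a decomposition are at least M, so below C + M each is less than C and lies in
    [gap_monoid]. Conversely, M, G, G + 1 are below C, so splitting one of them off leaves a nonzero
    rest. *)
Let last_decomposableE : last_decomposable S =
  [set` [seq alpha b * M + b * G + e | b <- iota 0 K.+1, e <- iota 0 b.+1]].
Proof.
set s := flatten _.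
rewrite /last_decomposable /last_interval (min_gensE subS) conductorE.
rewrite multiplicityE; apply/seteqP; split => x /=; rewrite {}/s.
  move=> [/andP[lo hi] natx].
  have [y [z [Sy Sz xyz y0 z0]]] :
      exists y z, [/\ S y, S z, x = y + z, 0 < y & 0 < z].
    apply: contrapT => H; apply: natx; split; [by apply/inS; right|lia|].
    move=> y z Sy Sz xyz.
    have [|y0] := posnP y; first by left.
    have [|z0] := posnP z; first by right.
    by case: H; exists y, z.
  have yM := pos_ge _ Sy y0; have zM := pos_ge _ Sz z0.
  have /inS[Ty|] := Sy; last by lia.
  have /inS[Tz|] := Sz; last by lia.
  have := gap_monoidD _ _ _ _ Ty Tz; rewrite -xyz => -[a [b [e [eb xE]]]].
  have bK : b <= K by apply: (level_le a b e); lia.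
  have aE : a = alpha b by apply: (coef_eq a b e) => //; lia.
  rewrite xE aE.
  by apply/allpairsPdep; exists b, e; split => //; rewrite mem_iota.
move=> /allpairsPdep[b [e [bK eb ->]]]; rewrite !mem_iota in bK eb.
have win := window b e; split; first by apply: win; lia.
move=> [_ _ irr].
have /andP[lo hi] : C <= alpha b * M + b * G + e < C + M by apply: win; lia.
(* Without a summand M, one of G, G + 1 is split off; b = 0 would give the element 0 < C. *)
case al0 : (alpha b) => [|a].
  case: b {bK} eb win lo hi irr al0 => [|b] eb _ lo hi irr al0; first by lia.
  rewrite al0 mulSn in lo hi irr.
  case: (irr (G + (e - b)) (b * G + minn e b)); try lia.
  - by apply/inS; left; exists 0, 1, (e - b); split; lia.
  - by apply/inS; left; exists 0, b, (minn e b); split; lia.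
rewrite al0 mulSn in lo hi irr.
case: (irr M (a * M + b * G + e)); try lia.
- by apply/inS; left; exists 1, 0, 0; split; lia.
- by apply/inS; left; exists a, b, e; split; lia.
Qed.

Let card_last_decomposable :
  card_set (last_decomposable S) = \sum_(b < K.+1) b.+1.
Proof.
rewrite last_decomposableE card_set_seq.
  rewrite size_allpairs_dep -(sumn_map_iota succn); congr sumn.
  by apply: eq_map => b; rewrite size_iota.
apply: allpairs_uniq_dep => [|b _|]; rewrite ?iota_uniq //.
move=> u v /allpairsPdep[b [e [bK eb ->]]].
move=> /allpairsPdep[b' [e' [bK' eb' ->]]] /=.
rewrite !mem_iota /= in bK bK' eb eb'.
by move/repr_inj => /(_ bK bK' eb eb')[_ -> ->].
Qed.

Lemma eliahou_gen_trunc : eliahou S =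
  (3 * (\sum_(b < K.+1) alpha b * b.+1)%:Z - Q%:Z * (\sum_(b < K.+1) b.+1)%:Z
   + r%:Z)%R.
Proof.
have [dE rE] : depth S = Q /\ rho S = r.
  by apply: depth_rho; rewrite ?conductorE multiplicityE.
by rewrite /eliahou card_atoms_left card_left_part card_last_decomposable dE rE.
Qed.

End EliahouGenTrunc.

(** * Two sum identities *)

Lemma sum_succ n : 2 * (\sum_(b < n) b.+1) = n * n.+1.
Proof.
elim: n => [|n IH]; first by rewrite big_ord0.
by rewrite big_ord_recr mulnDr IH -mulnDl mulnC addn2.
Qed.

(** Both sides are three times the binomial coefficient of n + 2 over 3. Raising n by one raises
    each weight n - b by one, which adds the plain sum. *)
Lemma sum_weighted_succ n :
  3 * (\sum_(b < n.+1) (n - b) * b.+1) = n * \sum_(b < n.+1) b.+1.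
Proof.
elim: n => [|n IH]; first by rewrite !big_ord_recl !big_ord0.
rewrite big_ord_recr /= subnn mul0n addn0.
have -> : \sum_(b < n.+1) (n.+1 - b) * b.+1 =
    \sum_(b < n.+1) (n - b) * b.+1 + \sum_(b < n.+1) b.+1.
  by rewrite -big_split; apply: eq_bigr => b _ /=; have := ltn_ord b; nia.
rewrite mulnDr IH [X in _ = _ * X]big_ord_recr /=.
by have := sum_succ n.+1; move: (\sum_(b < n.+1) b.+1) => T; nia.
Qed.

(** * Window, uniqueness and gap conditions for the family *)

Section Progression.
Variables (k N r i M G C : nat).
Hypotheses (k0 : 0 < k) (rN : k + 4 + r <= N) (MN : M = k * N + 2).
Hypothesis GN : G + N = (i + 2) * M.
Hypothesis Cr : C + r = (2 * k + i * k.+1) * M.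

(** Chosen so that, with Q = 2k + i(k + 1), [alpha b] + b(i + 2) is Q at b = 0, Q + 1 for 1 <= b <=
    k, and Q + 2 at b = k + 1, where the truncated subtraction gives 0 instead of -1. *)
Let alpha b := i * (k.+1 - b) + (2 * k + (b != 0) - 2 * b).

Let NM : N < M.
Proof. by rewrite MN; have := leq_mul k0 (leqnn N); lia. Qed.

(** As G = (i + 2)M - N, the element is hM + e - bN with h = a + b(i + 2): each level lowers the
    residue mod M by N. *)
Let level_shift a b e :
  a * M + b * G + e + b * N = (a + b * (i + 2)) * M + e.
Proof. by rewrite mulnDl -mulnA -GN mulnDr; lia. Qed.

Let window b e : b <= k.+1 -> e <= b ->
  C <= alpha b * M + b * G + e < C + M.
Proof.
move=> bk eb; have := level_shift (alpha b) b e.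
case: (posnP b) => [b0|b0].
  have -> : alpha b + b * (i + 2) = 2 * k + i * k.+1.
    by rewrite /alpha b0 /=; lia.
  by rewrite -Cr b0; lia.
move: bk; rewrite leq_eqVlt => /orP[/eqP bk|bk].
  have -> : alpha b + b * (i + 2) = 2 * k + i * k.+1 + 2.
    by rewrite /alpha bk subnn; lia.
  (* The value is C + M + r + 2 + e - N; since e <= k + 1, the bound [rN] is just enough to put it
     below C + M. *)
  by rewrite mulnDl -Cr [b * N](_ : _ = k * N + N); [lia|rewrite bk; lia].
have -> : alpha b + b * (i + 2) = 2 * k + i * k.+1 + 1.
  rewrite /alpha -lt0n b0 /=; have -> : i * k.+1 = i * (k.+1 - b) + i * b.
    by rewrite -mulnDr subnK // ltnW.
  lia.
have := leq_mul bk (leqnn N); have := leq_mul b0 (leqnn N); rewrite !mulSn.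
have : b * (k + 4 + r) <= b * N by rewrite leq_mul.
have : b + r <= b * (k + 4 + r) by rewrite !mulnDr; have := leq_pmull r b0; lia.
by rewrite mulnDl -Cr; lia.
Qed.

Let beyond : C + M <= k.+2 * G.
Proof.
have := level_shift 0 k.+2 0.
have -> : 0 + k.+2 * (i + 2) = 2 * k + i * k.+1 + (i + 4) by lia.
by rewrite mulnDl -Cr mulnDl !mulSn; lia.
Qed.

(** With d = b' - b, the number dN + e - e' is a multiple of M. For d = 0 its absolute value is
    below M; for 1 <= d <= k it lies strictly between 0 and M, because e <= k + 1 - d and kN = M -
    2. *)
Let repr_inj_le a b e a' b' e' : b <= b' -> b' <= k.+1 -> e <= b -> e' <= b' ->
  a * M + b * G + e = a' * M + b' * G + e' -> [/\ a = a', b = b' & e = e'].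
Proof.
move=> bb' bk eb eb' eqv.
have := level_shift a b e; have := level_shift a' b' e'; rewrite -eqv.
set h := a + _; set h' := a' + _ => E1 E2.
have [d b'E] : exists d, b' = b + d by exists (b' - b); lia.
have E : h * M + e + d * N = h' * M + e' by move: E1; rewrite b'E mulnDl; lia.
have [d0|d0] := posnP d.
  have {}E : h * M + e = h' * M + e' by move: E; rewrite d0; lia.
  have bM : b < M by lia.
  have b'b : b' = b by lia.
  have hE : h = h'.
    by case: (ltngtP h h') => // /leq_mul/(_ (leqnn M)); rewrite mulSn; lia.
  by split; [move: hE; rewrite /h /h' b'b|rewrite b'b|rewrite hE in E]; lia.
have Nd : N <= d * N by rewrite leq_pmull.
have hh' : h < h'.
  by rewrite ltnNge; apply/negP => /leq_mul/(_ (leqnn M)); lia.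
have [dk|kd] := leqP d k.
  have := leq_mul hh' (leqnn M); rewrite mulSn.
  have : (k - d) * 1 <= (k - d) * N by rewrite leq_mul //; lia.
  have : k * N = (k - d) * N + d * N by rewrite -mulnDl subnK.
  lia.
(* Now b = e = 0, and (k + 1)N - e' = M + N - 2 - e' lies strictly between M and 2M, since e' <= k +
   1 <= N - 3. *)
have dE : d = k.+1 by lia.
have [/leq_mul/(_ (leqnn M))|h'h] := ltnP h.+1 h'.
  by move: E; rewrite dE !mulSn; lia.
have h'E : h' = h.+1 by lia.
by move: E; rewrite dE h'E !mulSn; lia.
Qed.

(** Compare hM + e - bN with QM - r - 1. For b = 0 it is a multiple of M; for 1 <= b <= k it is too
    small if h <= Q and too large otherwise; for b = k + 1, h >= Q + 2 makes it too large. *)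
Let gapC : ~ gap_monoid M G C.-1.
Proof.
move=> [a [b [e [eb CE]]]]; have := level_shift a b e; rewrite -CE.
have C0 : 0 < C by have := window 0 0 isT isT; lia.
have bk : b <= k.+1.
  rewrite leqNgt; apply/negP => /leq_mul/(_ (leqnn G)); lia.
set h := a + _; have := Cr; set Q := 2 * k + _ => CQ.
have [b0|b0] := posnP b.
  rewrite b0 in eb * => E.
  have [/leq_mul/(_ (leqnn M))|/leq_mul/(_ (leqnn M))] := ltnP h Q;
    by rewrite ?mulSn; lia.
have [bk'|kb] := leqP b k.
  have := leq_mul bk' (leqnn N).
  have : b * (k + 4 + r) <= b * N by rewrite leq_mul.
  have : b + r + 1 < b * (k + 4 + r).
    by rewrite !mulnDr; have := leq_pmull r b0; have := leq_pmulr b k0; lia.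
  have [/leq_mul/(_ (leqnn M))|/leq_mul/(_ (leqnn M))] := ltnP Q h;
    by rewrite ?mulSn; lia.
have hQ : Q.+2 <= h by rewrite /h /Q (_ : b = k.+1); lia.
have := leq_mul hQ (leqnn M); rewrite (_ : b = k.+1) ?mulSn; lia.
Qed.

Lemma eliahou_progression :
  eliahou (gen_trunc [set M; G; G + 1] C) =
  (3 * (\sum_(b < k.+2) (2 * k + (b != 0 :> nat) - 2 * b) * b.+1)%:Z
   - (2 * k)%:Z * (\sum_(b < k.+2) b.+1)%:Z + r%:Z)%R.
Proof.
rewrite (eliahou_gen_trunc M G C (2 * k + i * k.+1) r k.+1 alpha) //;
  first last.
- move=> a b e a' b' e' bk bk' eb eb' eqv.
  have [bb'|/ltnW bb'] := leqP b b'; first exact: repr_inj_le.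
  by have [] := repr_inj_le a' b' e' a b e bb' bk eb' eb (esym eqv).
- have : (i + 2) * M <= (2 * k + i * k.+1) * M.
    by rewrite leq_mul //; have := leq_pmulr i (ltn0Sn k); lia.
  by lia.
- by move: GN; rewrite mulnDl; lia.
- by lia.
have -> : \sum_(b < k.+2) alpha b * b.+1 =
    i * \sum_(b < k.+2) (k.+1 - b) * b.+1 +
    \sum_(b < k.+2) (2 * k + (b != 0 :> nat) - 2 * b) * b.+1.
  rewrite big_distrr -big_split; apply: eq_bigr => b _ /=.
  by rewrite mulnDl mulnA.
(* The i-part of 3|L| equals i(k + 1) times the plain sum, which is the i-part of Q|D_q|. *)
have := sum_weighted_succ k.+1; nia.
Qed.

End Progression.

(** * Specialization to the given parameters *)

Theorem theorem5p14 (p tau i j : nat) (p_gt0 : 0 < p) (p_even : ~~ odd p) :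
  eliahou (Spt_ij p tau i j) = eliahou (Spt p tau).
Proof.
have -> : Spt p tau = Spt_ij p tau 0 0.
  by rewrite /Spt_ij /Sg_ij /Sc_ij /Sm_ij !mul0n !addn0.
have [k pE] : exists k, p = 2 * k by exists p./2; lia.
have p2 : p %/ 2 = k by lia.
have pp4 : p ^ 2 %/ 4 = k * k by rewrite pE expnMn mulKn.
have pp2 : p ^ 2 %/ 2 = 2 * (k * k).
  by rewrite pE expnMn -[2 ^ 2]/(2 * 2) -mulnA mulKn.
have k0 : 0 < k by lia.
(* This value depends only on k and tau, so it serves for both semigroups, the second being the case
   i = j = 0. *)
suff E i' j' : eliahou (Spt_ij p tau i' j') =
  (3 * (\sum_(b < k.+2) (2 * k + (b != 0 :> nat) - 2 * b) * b.+1)%:Z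
   - (2 * k)%:Z * (\sum_(b < k.+2) b.+1)%:Z + tau%:Z)%R by rewrite !E.
have muE : mu p = k * k + 4 * k + 2 by rewrite /mu pp4; lia.
have ME : Sm_ij p tau j' = k * (k + 4 + tau + j') + 2.
  by rewrite /Sm_ij /Sm muE p2; lia.
have kk : k <= k * k by rewrite leq_pmulr.
rewrite /Spt_ij.
apply: (eliahou_progression k (k + 4 + tau + j') tau i') => //; first by lia.
- rewrite /Sg_ij mulnDl addnAC addnC; congr (_ + _).
  rewrite ME /Sg /gamma muE p2 pE.
  (* These bounds keep the subtractions in tau(2k - 1) and j'(2k - 1) exact once expanded. *)
  have := leq_pmulr tau k0; have := leq_pmulr j' k0.
  rewrite !mulnBr; nia.
- rewrite /Sc_ij p2 pp2 -/(Sm_ij p tau j').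
  have tk : tau <= tau * (2 * (k * k)) by rewrite leq_pmulr //; lia.
  rewrite ME /Sc muE pp2 pE mulnBr; lia.
Qed.
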